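(* Let $N\geq 2$ be an integer and let $w_1,\ldots,w_{N-1}\geq 0$. Let $\{\mathbf{x}^{(l)}\}_{l\geq 0}$ be the (infinite) sequence generated by the MWISL algorithm (described in the context) from an arbitrary starting point $\mathbf{x}^{(0)}\in\mathcal{C}=\{\mathbf{x}\in\mathbf{C}^N : |x_n|=1,\ n=1,\ldots,N\}$. Then every limit point of the sequence $\{\mathbf{x}^{(l)}\}$ is a stationary point of the weighted integrated sidelobe level minimization problem $$\text{minimize } \sum_{k=1}^{N-1} w_k |r_k|^2 \quad\text{subject to } |x_n|=1,\ n=1,\ldots,N,$$ where $r_k=\sum_{n=1}^{N-k}x_n^{*}x_{n+k}$.
   Context: Notation: $(\cdot)^*$ is complex conjugation, $(\cdot)^T$ is transpose, $j=\sqrt{-1}$ in exponents, and $\arg$ is the phase of a complex number. ''Limit point'' of a sequence means the limit of a convergent subsequence. Autocorrelations. For $\mathbf{x}\in\mathbf{C}^N$, $r_k=\sum_{n=1}^{N-k}x_n^*x_{n+k}$ for $k=0,\ldots,N-1$, and $r_{-k}=r_k^*$. Write $r_k^{(l)}$ for the autocorrelations of $\mathbf{x}^{(l)}$. Extend the weights by $w_{-k}=w_k$ and $w_0=0$. MWISL algorithm. Set $\lambda_L=\max\{w_k(N-k) : k=1,\ldots,N-1\}$. Given $\mathbf{x}^{(l)}\in\mathcal{C}$, the next iterate $\mathbf{x}^{(l+1)}$ is computed as follows. 1. Form $\mathbf{c}=[0,w_1r_1^{(l)},\ldots,w_{N-1}r_{N-1}^{(l)},0,w_{N-1}r_{1-N}^{(l)},\ldots,w_1r_{-1}^{(l)}]^T\in\mathbf{C}^{2N}$.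 2. Compute $\boldsymbol{\mu}=\mathbf{F}\mathbf{c}$, where $\mathbf{F}$ is the $2N\times 2N$ discrete Fourier transform matrix with entries $F_{m,n}=e^{-j\frac{2mn\pi}{2N}}$, $0\leq m,n<2N$. The vector $\boldsymbol{\mu}$ is real; its entries are indexed $\mu_1,\ldots,\mu_{2N}$. 3. Set $\lambda_u=\frac12\left(\max_{1\leq i\leq N}\mu_{2i}+\max_{1\leq i\leq N}\mu_{2i-1}\right)$. 4. Let $\mathbf{R}$ be the $N\times N$ Hermitian Toeplitz matrix with entries $R_{i,m}=w_{i-m}\,r_{i-m}^{(l)}$, and set $\mathbf{y}=(\lambda_L N+\lambda_u)\mathbf{x}^{(l)}-\mathbf{R}\mathbf{x}^{(l)}$. 5. Set $x_n^{(l+1)}=e^{j\arg(y_n)}$ for $n=1,\ldots,N$ (if $y_n=0$, $\arg(y_n)$ may be taken to be any real number). The stopping test is ignored, so that the sequence is infinite. Stationary point. Identify $\mathbf{x}\in\mathbf{C}^N$ with $\tilde{\mathbf{x}}=[\mathrm{Re}(\mathbf{x})^T,\mathrm{Im}(\mathbf{x})^T]^T\in\mathbf{R}^{2N}$. Let $\tilde f(\tilde{\mathbf{x}})=\sum_{k=1}^{N-1}w_k|r_k|^2$ be the objective viewed as a (polynomial) function on $\mathbf{R}^{2N}$, and let $\tilde{\mathcal{C}}=\{\tilde{\mathbf{x}}\in\mathbf{R}^{2N} : \tilde x_n^2+\tilde x_{n+N}^2=1,\ n=1,\ldots,N\}$. A point $\mathbf{x}\in\mathcal{C}$ is a stationary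 point of the problem if the corresponding $\tilde{\mathbf{x}}\in\tilde{\mathcal{C}}$ satisfies the first-order optimality condition $\nabla\tilde f(\tilde{\mathbf{x}})^T\mathbf{z}\geq 0$ for all $\mathbf{z}\in T_{\tilde{\mathcal{C}}}(\tilde{\mathbf{x}})$, where $T_{\tilde{\mathcal{C}}}(\tilde{\mathbf{x}})$ is the tangent cone of $\tilde{\mathcal{C}}$ at $\tilde{\mathbf{x}}$. That is, $\mathbf{z}\in T_{\tilde{\mathcal{C}}}(\tilde{\mathbf{x}})$ if and only if there are $\tilde{\mathbf{x}}_i\in\tilde{\mathcal{C}}$ with $\tilde{\mathbf{x}}_i\to\tilde{\mathbf{x}}$ and scalars $\tau_i>0$ with $\tau_i\to 0$ such that $(\tilde{\mathbf{x}}_i-\tilde{\mathbf{x}})/\tau_i\to\mathbf{z}$. *)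

(* Defs.v *)
From mathcomp Require Import all_boot all_order all_algebra complex.
From mathcomp Require Import all_classical all_reals all_analysis.

Set Implicit Arguments.
Unset Strict Implicit.
Unset Printing Implicit Defensive.

Import Order.TTheory GRing.Theory Num.Theory.
Import numFieldNormedType.Exports.

Local Open Scope classical_set_scope.
Local Open Scope complex_scope.
Local Open Scope ring_scope.

(* Vectors of C^N are columns over R[i]; the indices n = 1, ..., N
   become the 0-based indices of 'I_N. *)

Section Problem.
Variables (R : realType) (N : nat).
Implicit Types (w : nat -> R) (x : 'cV[R[i]]_N).

Definition cis (t : R) : R[i] := cos t +i* sin t.

(* The sum runs over the pairs (n, m) of indices with m = n + k, i.e. over
   n = 1, ..., N - k with m = n + k. *)
Definition acorr_nat x (k : nat) : R[i] :=
  \sum_(n < N) \sum_(m < N | (m == n + k :> nat)%N) conjc (x n 0) * x m 0.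

Definition acorr x (k : int) : R[i] :=
  match k with
  | Posz p => acorr_nat x p
  | Negz p => conjc (acorr_nat x p.+1)
  end.

(* Only the values w 1, ..., w N.-1 of w : nat -> R are meaningful. *)
Definition wext w (k : int) : R := if k == 0 then 0 else w `|k|%N.

Definition unimodular : set 'cV[R[i]]_N :=
  [set x : 'cV[R[i]]_N | forall n, `|x n 0| = 1].

Definition wisl w x : R :=
  \sum_(1 <= k < N) w k * complex.Re `|acorr x k%:Z| ^+ 2.

(* The maximum of a nonempty list: the unit of the iterated max is taken in the
   list itself, so that it is also correct when all the values are negative. *)
Definition seqmax (s : seq R) : R := \big[Num.max/head 0 s]_(v <- s) v.

Definition lambdaL w : R := seqmax [seq w k * (N - k)%:R | k <- index_iota 1 N].

Definition cvec w x : 'cV[R[i]]_(2 * N) :=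
  \col_(i < 2 * N)
    if i == N :> nat then 0 else
    let k : int := if (i < N)%N then i%:Z else i%:Z - (2 * N)%:Z in
    (wext w k)%:C * acorr x k.

Definition dft : 'M[R[i]]_(2 * N) :=
  \matrix_(m < 2 * N, n < 2 * N)
    cis (- ((2 * m * n)%:R * pi / (2 * N)%:R)).

(* dft *m cvec w x is a real vector, by the symmetry of cvec w x. *)
Definition muvec w x : 'cV[R]_(2 * N) := map_mx (@complex.Re R) (dft *m cvec w x).

(* The 1-based even (resp. odd) indices 2i (resp. 2i - 1) of mu are the 0-based
   odd (resp. even) ones. *)
Definition lambdau w x : R :=
  (seqmax [seq muvec w x i 0 | i : 'I_(2 * N) <- enum 'I_(2 * N) & odd i] +
   seqmax [seq muvec w x i 0 | i : 'I_(2 * N) <- enum 'I_(2 * N) & ~~ odd i]) / 2.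

Definition Rmx w x : 'M[R[i]]_N :=
  \matrix_(i < N, m < N)
    ((wext w (i%:Z - m%:Z))%:C * acorr x (i%:Z - m%:Z)).

Definition yvec w x : 'cV[R[i]]_N :=
  (lambdaL w * N%:R + lambdau w x)%:C *: x - Rmx w x *m x.

(* When z = 0, every real number is an argument of z. *)
Definition is_arg (z : R[i]) (t : R) : Prop := z = `|z| * cis t.

(* A relation rather than a function, as the phase of a zero entry of yvec may
   be chosen arbitrarily. *)
Definition mwisl_step w x (x' : 'cV[R[i]]_N) : Prop :=
  forall n, exists t : R, is_arg (yvec w x n 0) t /\ x' n 0 = cis t.

Definition mwisl_sequence w (x : nat -> 'cV[R[i]]_N) : Prop :=
  unimodular (x 0%N) /\ forall l, mwisl_step w (x l) (x l.+1).

Definition realify x : 'cV[R]_(N + N) :=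
  col_mx (map_mx (@complex.Re R) x) (map_mx (@complex.Im R) x).

Definition complexify (v : 'cV[R]_(N + N)) : 'cV[R[i]]_N :=
  \col_n (usubmx v n 0 +i* dsubmx v n 0).

Definition wisl_real w (v : 'cV[R]_(N + N)) : R := wisl w (complexify v).

Definition torus : set 'cV[R]_(N + N) :=
  [set v : 'cV[R]_(N + N) | forall n : 'I_N, usubmx v n 0 ^+ 2 + dsubmx v n 0 ^+ 2 = 1].

(* Limits in C^N are taken through the identification of C^N with R^(2N). *)
Definition seq_limit_point (x : nat -> 'cV[R[i]]_N) (xs : 'cV[R[i]]_N) : Prop :=
  exists phi : nat -> nat,
    {homo phi : m n / (m < n)%N} /\
    realify (x (phi l)) @[l --> \oo] --> realify xs.

End Problem.

Definition gradient (R : realType) (d : nat) (f : 'cV[R]_d -> R)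
    (v : 'cV[R]_d) : 'cV[R]_d :=
  \col_(i < d) 'D_(delta_mx i 0 : 'cV[R]_d) f v.

Definition tangent_cone (R : realType) (d : nat) (C : set 'cV[R]_d)
    (v : 'cV[R]_d) : set 'cV[R]_d :=
  [set z : 'cV[R]_d | exists (u : nat -> 'cV[R]_d) (tau : nat -> R),
    [/\ (forall i, C (u i)), u i @[i --> \oo] --> v,
        (forall i, 0 < tau i), tau i @[i --> \oo] --> (0 : R) &
        (tau i)^-1 *: (u i - v) @[i --> \oo] --> z]].

Definition stationary_point (R : realType) (N : nat) (w : nat -> R)
    (x : 'cV[R[i]]_N) : Prop :=
  unimodular x /\
  forall z : 'cV[R]_(N + N), tangent_cone (@torus R N) (realify x) z ->
    0 <= ((gradient (wisl_real w) (realify x))^T *m z) 0 0.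

(* Main.v *)
Require Import Defs.
From mathcomp Require Import all_boot all_order all_algebra complex.
From mathcomp Require Import all_classical all_reals all_analysis.
From mathcomp Require Import ring lra zify.

(* With y = (lambda_L N + lambda_u) x - R x, the weighted ISL f satisfies, for
   unimodular x and a, the majorization f a <= f x - 2 Re <a - x, y>. It rests on
   two bounds: Cauchy-Schwarz along each diagonal of a a^H - x x^H gives
   lambda_L, and embedding the Toeplitz matrix R into the 2N-circulant matrix with
   eigenvalues mu gives R <= lambda_u, since the even and the odd DFT coefficients
   of a zero-padded vector carry the same energy.
   The step of the algorithm takes for a the phases of y, so f decreases by at
   least 2 (|y_n| - Re (x_n^* y_n)) >= 0 for every n. As f >= 0, these decrements
   tend to 0, and since y is bounded on the torus, so does
   Im (x_n^* y_n) = - Im (x_n^* (R x)_n). At a limit point every x_n^* (R x)_n is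
   thus real, while the gradient of f is 2 R x and a tangent vector z satisfies
   Re (x_n^* z_n) = 0: the gradient is orthogonal to the tangent cone. *)

Set Implicit Arguments.
Unset Strict Implicit.
Unset Printing Implicit Defensive.

Import Order.TTheory GRing.Theory Num.Theory.
Import numFieldNormedType.Exports.

Local Open Scope classical_set_scope.
Local Open Scope complex_scope.
Local Open Scope ring_scope.

Local Notation Re := complex.Re.
Local Notation Im := complex.Im.

(** Off the diagonal, each entry is paired with its transpose and the pairs are grouped by the index
    difference [k], which is how autocorrelations and Toeplitz matrices are organized. *)
Lemma sum_diag_split (V : zmodType) (N : nat) (F : 'I_N -> 'I_N -> V) :
  \sum_n \sum_m F n m = \sum_n F n n +
    \sum_(1 <= k < N) \sum_(n < N) \sum_(m < N | (m == n + k :> nat)%N)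
      (F n m + F m n).
Proof.
have -> : \sum_(1 <= k < N) \sum_(n < N) \sum_(m < N | (m == n + k :> nat)%N)
    (F n m + F m n) = \sum_(n < N) \sum_(m < N) (F n m + F m n) *+ (n < m)%N.
  rewrite exchange_big; apply: eq_bigr => n _ /=.
  rewrite (eq_bigr (fun k => \sum_(m < N) (F n m + F m n) *+ (m == n + k :> nat)%N)); last first.
    by move=> k _; rewrite big_mkcond; apply: eq_bigr => m _; rewrite mulrb.
  rewrite exchange_big; apply: eq_bigr => m _ /=.
  (* It remains to count the [k] in [1, N) with m = n + k: there is exactly one when n < m, and none
     otherwise. *)
  rewrite sumrMnr; congr (_ *+ _).
  case: ltnP => nm /=.
    rewrite (big_cat_nat (n := (m - n)%N)) //=; [|lia|have := ltn_ord m; lia].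
    rewrite [X in (_ + X)%N]big_ltn //=; last by have := ltn_ord m; lia.
    rewrite big_nat_cond big1 => [|k]; last by case/andP => H _; apply/eqP; lia.
    rewrite big_nat_cond big1 => [|k]; last by case/andP => H _; apply/eqP; lia.
    lia.
  by rewrite big_nat_cond big1 => [|k] //; case/andP => H _; apply/eqP; lia.
have -> : \sum_(n < N) \sum_(m < N) (F n m + F m n) *+ (n < m)%N =
    \sum_(n < N) \sum_(m < N) F n m *+ (n != m).
  transitivity (\sum_(n < N) \sum_(m < N) F n m *+ (n < m)%N +
                \sum_(n < N) \sum_(m < N) F n m *+ (m < n)%N).
    rewrite [X in _ + X]exchange_big -big_split; apply: eq_bigr => n _ /=.
    by rewrite -big_split; apply: eq_bigr => m _; rewrite mulrnDl.
  rewrite -big_split; apply: eq_bigr => n _ /=.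
  rewrite -big_split; apply: eq_bigr => m _ /=; rewrite -mulrnDr; congr (_ *+ _).
  by rewrite -val_eqE /=; lia.
rewrite -big_split; apply: eq_bigr => n _ /=.
rewrite (bigD1 n) //= [in RHS](bigD1 n) //= eqxx mulr0n add0r; congr (_ + _).
by apply: eq_bigr => m; rewrite eq_sym => ->.
Qed.

(** * Real and imaginary parts, real inner product and squared modulus on C *)

Section ComplexPlane.
Variable R : realType.
Implicit Types z a b c : R[i].

(* Re (a^* b) *)
Definition dotc a b : R := Re a * Re b + Im a * Im b.
Definition sqn z : R := dotc z z.

Lemma ReD a b : Re (a + b) = Re a + Re b. Proof. by case: a b => [? ?] []. Qed.
Lemma ImD a b : Im (a + b) = Im a + Im b. Proof. by case: a b => [? ?] []. Qed.
Lemma ReN a : Re (- a) = - Re a. Proof. by case: a. Qed.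
Lemma ImN a : Im (- a) = - Im a. Proof. by case: a. Qed.
Lemma ReM a b : Re (a * b) = Re a * Re b - Im a * Im b.
Proof. by case: a b => [? ?] []. Qed.
Lemma ImM a b : Im (a * b) = Re a * Im b + Im a * Re b.
Proof. by case: a b => [? ?] []. Qed.
Lemma Re_conj a : Re (conjc a) = Re a. Proof. by case: a. Qed.
Lemma Im_conj a : Im (conjc a) = - Im a. Proof. by case: a. Qed.

Lemma Re_sum (I : Type) (r : seq I) (P : pred I) (F : I -> R[i]) :
  Re (\sum_(i <- r | P i) F i) = \sum_(i <- r | P i) Re (F i).
Proof. exact: (big_morph _ ReD). Qed.
Lemma Im_sum (I : Type) (r : seq I) (P : pred I) (F : I -> R[i]) :
  Im (\sum_(i <- r | P i) F i) = \sum_(i <- r | P i) Im (F i).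
Proof. exact: (big_morph _ ImD). Qed.

Definition ReImE := (ReD, ImD, ReN, ImN, ReM, ImM, Re_conj, Im_conj).

Lemma complex_ext a b : Re a = Re b -> Im a = Im b -> a = b.
Proof. by case: a b => [? ?] [? ?] /= -> ->. Qed.

Lemma dotcC a b : dotc a b = dotc b a.
Proof. rewrite /dotc; ring. Qed.
Lemma dotcDr a b c : dotc a (b + c) = dotc a b + dotc a c.
Proof. rewrite /dotc !ReImE; ring. Qed.
Lemma dotc_sumr (I : Type) (r : seq I) (P : pred I) (F : I -> R[i]) a :
  dotc a (\sum_(i <- r | P i) F i) = \sum_(i <- r | P i) dotc a (F i).
Proof. by apply: (big_morph _ (dotcDr a)); rewrite /dotc /= !mulr0 addr0. Qed.

Lemma sqn_ge0 z : 0 <= sqn z.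
Proof. by rewrite /sqn /dotc -!expr2 addr_ge0 ?sqr_ge0. Qed.

Lemma sqnE z : Re `|z| ^+ 2 = sqn z.
Proof. by rewrite normc_def /= sqr_sqrtr // addr_ge0 ?sqr_ge0. Qed.

Lemma norm1_sqn z : `|z| = 1 <-> sqn z = 1.
Proof.
split=> [z1|]; first by rewrite -sqnE z1 /= expr1n.
by rewrite /sqn /dotc normc_def !expr2 => ->; rewrite sqrtr1.
Qed.

(** The square expands into the terms [dotc (F i) (F j)], each at most the mean of [sqn (F i)] and
    [sqn (F j)]; by symmetry these means add up to the right-hand side. *)
Lemma cauchy_sqn (I : finType) (P : pred I) (F : I -> R[i]) :
  sqn (\sum_(i | P i) F i) <= #|P|%:R * \sum_(i | P i) sqn (F i).
Proof.
rewrite /sqn dotc_sumr.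
apply: (@le_trans _ _ (\sum_(i | P i) \sum_(j | P j)
    ((sqn (F i) + sqn (F j)) / 2))).
  apply: ler_sum => i _; rewrite dotcC dotc_sumr; apply: ler_sum => j _.
  have := sqn_ge0 (F i - F j).
  rewrite /sqn /dotc !ReImE; nra.
rewrite le_eqVlt; apply/orP; left; apply/eqP.
have -> : #|P|%:R * \sum_(i | P i) sqn (F i) = \sum_(i | P i) \sum_(j | P j) sqn (F i).
  rewrite mulr_sumr; apply: eq_bigr => i _.
  by rewrite sumr_const mulr_natl.
transitivity ((\sum_(i | P i) \sum_(j | P j) sqn (F i) +
   \sum_(i | P i) \sum_(j | P j) sqn (F j)) / 2).
  rewrite -big_split /= mulr_suml; apply: eq_bigr => i _.
  by rewrite -big_split /= mulr_suml.
rewrite [X in _ + X]exchange_big; lra.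
Qed.

End ComplexPlane.

(** * Expansion of the objective, and the bound by [lambdaL] *)

Section Hermitian.
Variables (R : realType) (N : nat).
Implicit Types (w : nat -> R) (x a b d : 'cV[R[i]]_N).

(** The sesquilinear form obtained by polarizing [acorr_nat], used to expand the autocorrelations of
    a sum. *)
Definition xcorr a b (k : nat) : R[i] :=
  \sum_(n < N) \sum_(m < N | (m == n + k :> nat)%N) conjc (a n 0) * b m 0.

Lemma acorr_natE x k : acorr_nat x k = xcorr x x k. Proof. by []. Qed.

Lemma xcorrDl a b d k : xcorr (a + b) d k = xcorr a d k + xcorr b d k.
Proof.
rewrite /xcorr -big_split; apply: eq_bigr => n _ /=.
rewrite -big_split; apply: eq_bigr => m _ /=.
by rewrite mxE rmorphD mulrDl.
Qed.

Lemma xcorrDr a b d k : xcorr d (a + b) k = xcorr d a k + xcorr d b k.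
Proof.
rewrite /xcorr -big_split; apply: eq_bigr => n _ /=.
rewrite -big_split; apply: eq_bigr => m _ /=.
by rewrite mxE mulrDr.
Qed.

Lemma wislE w x : wisl w x = \sum_(1 <= k < N) w k * sqn (acorr_nat x k).
Proof. by apply: eq_bigr => k _; rewrite sqnE. Qed.

(** This is Re (a^H b), the Euclidean inner product of C^N seen as R^(2N). *)
Definition rdot a b : R := \sum_n dotc (a n 0) (b n 0).

Lemma rdotDr a b d : rdot a (b + d) = rdot a b + rdot a d.
Proof.
by rewrite /rdot -big_split; apply: eq_bigr => n _; rewrite mxE dotcDr.
Qed.

Lemma rdotC a b : rdot a b = rdot b a.
Proof. by apply: eq_bigr => n _; rewrite dotcC. Qed.

Lemma rdotNr a b : rdot a (- b) = - rdot a b.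
Proof.
rewrite /rdot -sumrN; apply: eq_bigr => n _.
by rewrite mxE /dotc !ReImE; ring.
Qed.

Lemma rdotZr a b (t : R) : rdot a (t%:C *: b) = t * rdot a b.
Proof.
rewrite /rdot mulr_sumr; apply: eq_bigr => n _.
by rewrite mxE /dotc !ReImE /=; ring.
Qed.

Lemma Rmx_diag w x n : Rmx w x n n = 0.
Proof. by rewrite mxE subrr /wext eqxx mul0r. Qed.

Lemma Rmx_lower w x (n m : 'I_N) k : (0 < k)%N -> (m == n + k :> nat)%N ->
  Rmx w x m n = (w k)%:C * acorr_nat x k.
Proof.
move=> k0 /eqP mE; rewrite mxE mE PoszD addrC addKr /wext /acorr.
by case: k k0 {mE} => [//|k] _.
Qed.

Lemma Rmx_upper w x (n m : 'I_N) k : (0 < k)%N -> (m == n + k :> nat)%N ->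
  Rmx w x n m = (w k)%:C * conjc (acorr_nat x k).
Proof.
move=> k0 /eqP mE; rewrite mxE mE PoszD opprD addrA subrr add0r /wext /acorr.
by case: k k0 {mE} => [//|k] _.
Qed.

(** [Rmx w x] is constant along diagonals, and the two diagonals at distance [k] carry conjugate
    values, so each such pair contributes a single inner product with [acorr_nat x k]. *)
Lemma rdot_Rmx w x a b : rdot a (Rmx w x *m b) =
  \sum_(1 <= k < N) w k * dotc (acorr_nat x k) (xcorr a b k + xcorr b a k).
Proof.
transitivity (\sum_n \sum_m dotc (a n 0) (Rmx w x n m * b m 0)).
  by apply: eq_bigr => n _; rewrite mxE dotc_sumr.
rewrite sum_diag_split big1 ?add0r => [|n _]; last first.
  by rewrite Rmx_diag mul0r /dotc /= !mulr0 addr0.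
apply: eq_big_nat => k /andP[k0 kN].
rewrite dotcDr /xcorr !dotc_sumr -big_split mulr_sumr; apply: eq_bigr => n _ /=.
rewrite !dotc_sumr -big_split mulr_sumr; apply: eq_bigr => m mE /=.
rewrite (Rmx_lower w x k0 mE) (Rmx_upper w x k0 mE) /dotc !ReImE /=; ring.
Qed.

Lemma acorr_natD x d k : acorr_nat (x + d) k =
  acorr_nat x k + (xcorr x d k + xcorr d x k) + xcorr d d k.
Proof. by rewrite !acorr_natE xcorrDl !xcorrDr; ring. Qed.

(** Expand |r + s|^2 with s the increment of the k-th autocorrelation. In the cross term, the part
    of s linear in [d] gives [2 * rdot d (Rmx w x *m x)]; the quadratic part gives
    [rdot d (Rmx w x *m d)] without a factor 2, since [rdot_Rmx] with a = b = d counts [xcorr d d k]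
    twice. *)
Lemma wislD w x d : wisl w (x + d) = wisl w x + 2 * rdot d (Rmx w x *m x) +
  rdot d (Rmx w x *m d) +
  \sum_(1 <= k < N) w k * sqn (acorr_nat (x + d) k - acorr_nat x k).
Proof.
rewrite !wislE !rdot_Rmx mulr_sumr -!big_split; apply: eq_bigr => k _ /=.
rewrite acorr_natD /sqn /dotc !ReImE; ring.
Qed.

Lemma ler_seqmax (s : seq R) v : v \in s -> v <= seqmax s.
Proof. by move=> vs; rewrite /seqmax (@le_bigmax_seq _ _ _ _ _ _ xpredT idfun). Qed.

Lemma ler_lambdaL w k : (1 <= k < N)%N -> w k * (N - k)%:R <= lambdaL N w.
Proof.
move=> kN; apply: ler_seqmax; apply/mapP; exists k => //.
by rewrite mem_index_iota.
Qed.

(** A pair on the k-th diagonal is determined by its first index, which is below N - k; for N <= k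
    the diagonal is empty and the truncated difference is 0. *)
Lemma card_diag k : (#|[pred p : 'I_N * 'I_N | (p.2 == p.1 + k :> nat)%N]| <= N - k)%N.
Proof.
case: (leqP N k) => [Nk|kN].
  rewrite (_ : (N - k = 0)%N); last by lia.
  rewrite leqn0; apply/eqP/eq_card0 => -[n m]; rewrite !inE /=.
  by have := ltn_ord m; lia.
rewrite -[leqRHS](card_ord (N - k)) -(@card_in_imset _ _ (fun p : 'I_N * 'I_N => p.1)).
  apply: leq_trans (_ : #|[set widen_ord (leq_subr k N) i | i : 'I_(N - k)]| <= _)%N.
    apply: subset_leq_card; apply/fintype.subsetP => n /imsetP[[n' m]]; rewrite !inE /= => /eqP mE ->.
    have nk : (n' < N - k)%N by have := ltn_ord m; lia.
    by apply/imsetP; exists (Ordinal nk) => //; apply: val_inj.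
  by rewrite leq_imset_card.
move=> [n m] [n' m']; rewrite !inE /= => /eqP mE /eqP mE' nn'; subst n'.
by congr (_, _); apply: val_inj; rewrite /= mE mE'.
Qed.

Lemma sqn_diag_sum (D : 'I_N -> 'I_N -> R[i]) k :
  sqn (\sum_(n < N) \sum_(m < N | (m == n + k :> nat)%N) D n m) <=
  (N - k)%:R * \sum_(n < N) \sum_(m < N | (m == n + k :> nat)%N) sqn (D n m).
Proof.
rewrite !pair_big_dep /=; apply: (le_trans (cauchy_sqn _ _)).
apply: ler_wpM2r; first by apply: sumr_ge0 => p _; apply: sqn_ge0.
by rewrite ler_nat; apply: leq_trans (card_diag k); apply: eq_leq; apply: eq_card.
Qed.

Lemma lambdaL_ge0 w : (2 <= N)%N -> (forall k, (1 <= k < N)%N -> 0 <= w k) ->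
  0 <= lambdaL N w.
Proof.
move=> N2 w0; apply: le_trans (ler_lambdaL w (_ : 1 <= 1 < N)%N) => //.
by rewrite mulr_ge0 ?w0.
Qed.

(* The off-diagonal entries of the Hermitian matrix a a^H - x x^H come in conjugate
   pairs, hence the factor 1 / 2. *)
Lemma acorr_dist w a x : (2 <= N)%N -> (forall k, (1 <= k < N)%N -> 0 <= w k) ->
  \sum_(1 <= k < N) w k * sqn (acorr_nat a k - acorr_nat x k) <=
  lambdaL N w / 2 * \sum_(n < N) \sum_(m < N)
     sqn (conjc (a n 0) * a m 0 - conjc (x n 0) * x m 0).
Proof.
move=> N2 w0; pose D n m := conjc (a n 0) * a m 0 - conjc (x n 0) * x m 0.
rewrite -/(\sum_n \sum_m sqn (D n m)) sum_diag_split.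
(* The diagonal terms of the full double sum are nonnegative and are dropped. *)
apply: (@le_trans _ _ (lambdaL N w / 2 * \sum_(1 <= k < N) \sum_(n < N)
    \sum_(m < N | (m == n + k :> nat)%N) (sqn (D n m) + sqn (D m n)))); last first.
  rewrite ler_wpM2l ?divr_ge0 ?lambdaL_ge0 // lerDr.
  by apply: sumr_ge0 => n _; apply: sqn_ge0.
rewrite mulr_sumr ler_sum_nat // => k kN.
have -> : acorr_nat a k - acorr_nat x k =
    \sum_(n < N) \sum_(m < N | (m == n + k :> nat)%N) D n m.
  rewrite /acorr_nat -sumrB; apply: eq_bigr => n _.
  by rewrite -sumrB.
apply: le_trans (ler_wpM2l (w0 k kN) (sqn_diag_sum D k)) _.
set S := \sum_n \sum_(_ | _) sqn _.
have -> : \sum_(n < N) \sum_(m < N | (m == n + k :> nat)%N) (sqn (D n m) + sqn (D m n))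
    = 2 * S.
  rewrite mulr_sumr; apply: eq_bigr => n _; rewrite mulr_sumr; apply: eq_bigr => m _.
  by rewrite /D /sqn /dotc !ReImE; ring.
have S0 : 0 <= S by apply: sumr_ge0 => n _; apply: sumr_ge0 => m _; apply: sqn_ge0.
rewrite [leRHS]mulrA divfK ?pnatr_eq0 // [leLHS]mulrA.
by rewrite ler_wpM2r // ler_lambdaL.
Qed.

(** The left-hand side is the squared Frobenius norm of a a^H - x x^H. With p = x^H a it equals 2
    (N^2 - |p|^2), and [rdot x a] is the real part of p. *)
Lemma outer_dist a x : unimodular a -> unimodular x ->
  \sum_(n < N) \sum_(m < N)
     sqn (conjc (a n 0) * a m 0 - conjc (x n 0) * x m 0) <=
  2 * (N%:R ^+ 2 - rdot x a ^+ 2).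
Proof.
move=> Ua Ux; pose p := \sum_n conjc (x n 0) * a n 0.
have Rep : Re p = rdot x a.
  by rewrite Re_sum; apply: eq_bigr => n _; rewrite /dotc !ReImE; ring.
have -> : \sum_(n < N) \sum_(m < N)
    sqn (conjc (a n 0) * a m 0 - conjc (x n 0) * x m 0) =
    2 * (N%:R ^+ 2 - sqn p).
  (* All entries have modulus 1. The inner product of two entries is regrouped as that of x_n^* a_n
     and x_m^* a_m, so that the double sum becomes |p|^2. *)
  transitivity (\sum_(n < N) \sum_(m < N)
     (2 - 2 * dotc (conjc (x n 0) * a n 0) (conjc (x m 0) * a m 0))).
    apply: eq_bigr => n _; apply: eq_bigr => m _.
    have [an am] := (Ua n, Ua m); have [xn xm] := (Ux n, Ux m).
    move: an am xn xm => /norm1_sqn + /norm1_sqn + /norm1_sqn + /norm1_sqn.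
    move: (a n 0) (a m 0) (x n 0) (x m 0) => u u' v v' hu hu' hv hv'.
    transitivity (sqn u * sqn u' + sqn v * sqn v' -
      2 * dotc (conjc v * u) (conjc v' * u')); last by rewrite hu hu' hv hv'; ring.
    by rewrite /sqn /dotc !ReImE; ring.
  transitivity (\sum_(n < N) (2 * N%:R - 2 * dotc (conjc (x n 0) * a n 0) p)).
    apply: eq_bigr => n _; rewrite sumrB sumr_const card_ord -mulr_sumr -dotc_sumr.
    by rewrite mulr_natr.
  rewrite sumrB sumr_const card_ord -mulr_sumr.
  under eq_bigr do rewrite dotcC.
  by rewrite -dotc_sumr -/p -mulr_natr -/(sqn p); ring.
rewrite ler_pM2l ?ltr0n // lerD2l lerN2 /sqn /dotc -Rep.
by rewrite -!expr2 lerDl sqr_ge0.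
Qed.
End Hermitian.

(** * Roots of unity and their orthogonality relations *)

Section RootsOfUnity.
Variable R : realType.

Lemma cisD (s t : R) : cis (s + t) = cis s * cis t.
Proof. by apply: complex_ext; rewrite !ReImE /= ?cosD ?sinD; ring. Qed.

Lemma cis0 : cis 0 = 1 :> R[i].
Proof. by rewrite /cis cos0 sin0. Qed.

Lemma cisX (t : R) n : cis (t * n%:R) = cis t ^+ n.
Proof.
elim: n => [|n IH]; first by rewrite mulr0 cis0.
by rewrite exprS -IH -cisD; congr cis; rewrite -natr1; ring.
Qed.

Lemma conj_cis (t : R) : conjc (cis t) = cis (- t).
Proof. by rewrite /cis cosN sinN. Qed.

Lemma conjcM (a b : R[i]) : conjc (a * b) = conjc a * conjc b.
Proof. exact: rmorphM. Qed.

Lemma conjcX (a : R[i]) n : conjc (a ^+ n) = conjc a ^+ n.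
Proof. exact: rmorphXn. Qed.

Lemma conjc_sum (I : Type) (r : seq I) (P : pred I) (F : I -> R[i]) :
  conjc (\sum_(i <- r | P i) F i) = \sum_(i <- r | P i) conjc (F i).
Proof. exact: rmorph_sum. Qed.

Lemma sqn_cis (t : R) : sqn (cis t) = 1.
Proof. by rewrite /sqn /dotc /= -!expr2 cos2Dsin2. Qed.

Definition uroot M : R[i] := cis (- (2 * pi / M%:R)).

Lemma urootX M : (0 < M)%N -> uroot M ^+ M = 1.
Proof.
move=> M0; rewrite -cisX mulNr divfK ?pnatr_eq0 -?lt0n //.
by rewrite -conj_cis /cis mulr_natl cos2pi sin2pi /= oppr0.
Qed.

(** With t = pi k / M, the equality would give cos (2 t) = 1 and hence sin t = 0, whereas 0 < t <
    pi. *)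
Lemma uroot_neq1 M k : (0 < k < M)%N -> uroot M ^+ k != 1.
Proof.
move=> /andP[k0 kM]; apply/eqP => /(congr1 (@complex.Re R)).
rewrite -cisX /= mulNr cosN.
pose t : R := pi * k%:R / M%:R.
have M0 : (0 : R) < M%:R by rewrite ltr0n; lia.
have -> : 2 * pi / M%:R * k%:R = t *+ 2.
  by rewrite -mulr_natl /t; field; rewrite gt_eqF.
rewrite cos_mulr2n => ct; have : 0 < sin t.
  apply: sin_gt0_pi; rewrite /t divr_gt0 ?mulr_gt0 ?pi_gt0 ?(ltr0n _ k) //=.
  by rewrite ltr_pdivrMr // ltr_pM2l ?pi_gt0 // ltr_nat.
move=> s0; have := cos2Dsin2 t; have := mulr_gt0 s0 s0; move: ct; rewrite -expr2; lra.
Qed.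

(** A geometric sum, whose ratio [uroot M ^+ e] is 1 exactly when [M] divides [e]. *)
Lemma sum_uroot M e : (0 < M)%N ->
  \sum_(i < M) uroot M ^+ (i * e) = if (M %| e)%N then M%:R else 0.
Proof.
move=> M0; case: ifPn => [/dvdnP[q ->]|eM].
  rewrite -[in RHS](card_ord M) -sumr_const; apply: eq_bigr => i _.
  by rewrite mulnA mulnC exprM urootX // expr1n.
have u1 : uroot M ^+ e != 1.
  rewrite (divn_eq e M) exprD mulnC exprM urootX // expr1n mul1r.
  by rewrite uroot_neq1 // ltn_mod M0 andbT lt0n.
rewrite -subr_eq0 in u1; apply: (mulfI u1); rewrite mulr0.
under eq_bigr do rewrite mulnC exprM.
by rewrite -subrX1 -exprM mulnC exprM urootX // expr1n subrr.
Qed.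

(** Conjugation inverts a root of unity; writing the opposite exponent as [M - n] keeps it a natural
    number, as [sum_uroot] requires. *)
Lemma conj_urootX M n i : (n <= M)%N -> (0 < M)%N ->
  conjc (uroot M ^+ (i * n)) = uroot M ^+ (i * (M - n)).
Proof.
move=> nM M0; have u0 : uroot M != 0.
  apply/eqP => u0; have := urootX M0; rewrite u0 expr0n gtn_eqF //.
  by move/eqP; rewrite eq_sym oner_eq0.
apply: (mulfI (expf_neq0 (i * n) u0)); rewrite -exprD -mulnDr subnKC //.
rewrite (mulnC i M) (exprM _ M i) urootX // expr1n.
by rewrite conjcX -exprMn /uroot conj_cis -cisD subrr cis0 expr1n.
Qed.

Lemma Re_mulC (z : R[i]) : Re (z * conjc z) = sqn z.
Proof. by rewrite /sqn /dotc !ReImE; ring. Qed.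

End RootsOfUnity.

(** * Circulant embedding of the Toeplitz matrix, and the bound by [lambdau] *)

Section Circulant.
Variables (R : realType) (N : nat).
Implicit Types (w : nat -> R) (x d : 'cV[R[i]]_N).
Hypothesis N0 : (0 < N)%N.

Lemma dftE (i q : 'I_(2 * N)) : dft R N i q = uroot R (2 * N) ^+ (i * q).
Proof.
rewrite mxE -cisX; congr cis; rewrite !natrM mulNr; congr (- _).
by field; rewrite pnatr_eq0; lia.
Qed.

(* The DFT of d followed by N zeros: with this padding the circular convolution by
   cvec w x computes Rmx w x *m d. *)
Definition padded_dft d (i : 'I_(2 * N)) : R[i] :=
  \sum_(n < N) uroot R (2 * N) ^+ (i * n) * d n 0.

Lemma padded_dft_mul d (i : 'I_(2 * N)) (e : nat) :
  uroot R (2 * N) ^+ (i * e) * (padded_dft d i * conjc (padded_dft d i)) =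
  \sum_(m < N) \sum_(n < N)
    d m 0 * conjc (d n 0) * uroot R (2 * N) ^+ (i * (e + m + (2 * N - n))).
Proof.
rewrite conjc_sum mulr_suml mulr_sumr; apply: eq_bigr => m _.
rewrite !mulr_sumr; apply: eq_bigr => n _.
rewrite conjcM conj_urootX; [|have := ltn_ord n; lia|lia].
by rewrite !mulnDr !exprD; ring.
Qed.

(** Orthogonality keeps the pairs with n = e + m modulo 2N. The shift e = 0 yields the total energy,
    e = N the alternating one, and e = q the q-th coefficient of the circulant matrix. *)
Lemma sum_padded_dft d (e : nat) :
  \sum_(i < 2 * N) uroot R (2 * N) ^+ (i * e) * (padded_dft d i * conjc (padded_dft d i)) =
  \sum_(m < N) \sum_(n < N) d m 0 * conjc (d n 0) *
    (if (2 * N %| e + m + (2 * N - n))%N then (2 * N)%:R else 0).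
Proof.
under eq_bigr do rewrite padded_dft_mul //.
rewrite exchange_big; apply: eq_bigr => m _ /=.
rewrite exchange_big; apply: eq_bigr => n _ /=.
by rewrite -mulr_sumr sum_uroot //; lia.
Qed.

Lemma sum_sqn_padded_dft d :
  \sum_i sqn (padded_dft d i) = (2 * N)%:R * rdot d d.
Proof.
transitivity (Re (\sum_(i < 2 * N) uroot R (2 * N) ^+ (i * 0) *
    (padded_dft d i * conjc (padded_dft d i)))).
  by rewrite Re_sum; apply: eq_bigr => i _; rewrite muln0 mul1r Re_mulC.
rewrite sum_padded_dft Re_sum mulr_sumr; apply: eq_bigr => m _.
rewrite (bigD1 m) //= big1 => [|n nm].
  rewrite add0n subnKC; last by have := ltn_ord m; lia.
  rewrite dvdnn addr0 -(rmorph_nat (real_complex R)) ReM Re_mulC /sqn /=; ring.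
case: ifPn => [/dvdnP[k kE]|_]; last by rewrite mulr0.
have [mN nN] := (ltn_ord m, ltn_ord n).
(* The number m + 2N - n lies strictly between 0 and 4N. *)
have k1 : k = 1%N by nia.
by move: nm; rewrite -val_eqE /=; lia.
Qed.

(* The even and the odd frequencies carry the same energy: (-1)^i is the frequency
   shift by N, and no two indices below N differ by N. *)
Lemma sum_alt_sqn_padded_dft d :
  \sum_(i < 2 * N) (-1) ^+ i * sqn (padded_dft d i) = 0.
Proof.
have uN : uroot R (2 * N) ^+ N = (-1)%:C.
  rewrite -cisX mulNr natrM.
  rewrite (_ : 2 * pi / (2 * N%:R) * N%:R = pi); first by rewrite -conj_cis /cis cospi sinpi /= oppr0.
  by field; rewrite pnatr_eq0; lia.
transitivity (Re (\sum_(i < 2 * N) uroot R (2 * N) ^+ (i * N) *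
    (padded_dft d i * conjc (padded_dft d i)))).
  rewrite Re_sum; apply: eq_bigr => i _.
  by rewrite (mulnC i) exprM uN -rmorphXn ReM Re_mulC /= mul0r subr0.
rewrite sum_padded_dft big1 // => m _; rewrite big1 // => n _.
case: ifPn => [/dvdnP[k kE]|_]; last by rewrite mulr0.
have [mN nN] := (ltn_ord m, ltn_ord n).
(* The number N + m + 2N - n lies strictly between 2N and 4N, so it is no multiple of 2N. *)
have k1 : (1 < k)%N by nia.
have k2 : (k < 2)%N by nia.
lia.
Qed.

(** [Rmx w x] is the leading N x N block of the circulant matrix with first column [cvec w x]: the
    divisibility condition selects the coefficient at n - m modulo 2N. *)
Lemma sum_cvec w x (n m : 'I_N) :
  \sum_(q < 2 * N) cvec w x q 0 *
    (if (2 * N %| q + m + (2 * N - n))%N then (2 * N)%:R else 0) =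
  (2 * N)%:R * Rmx w x n m.
Proof.
have [mN nN] := (ltn_ord m, ltn_ord n).
(* The residue of n - m modulo 2N; as |n - m| < N, it is never the index N, where [cvec] has its
   padding zero. *)
pose q0 := if (m <= n)%N then (n - m)%N else (2 * N + n - m)%N.
have q0M : (q0 < 2 * N)%N by rewrite /q0; case: ifP => h; lia.
rewrite (bigD1 (Ordinal q0M)) //= big1 ?addr0 => [|q qq0]; last first.
  case: ifPn => [/dvdnP[k kE]|_]; last by rewrite mulr0.
  have qM := ltn_ord q.
  have k1 : (0 < k)%N by nia.
  have k2 : (k < 3)%N by nia.
  case/eqP: qq0; apply: val_inj; rewrite /= /q0.
  (* The multiples 2N and 4N correspond to the two branches of [q0]. *)
  case: k {k1} k2 kE => [|[|[|k]]] // _ kE; case: ifP => h; lia.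
rewrite (_ : (2 * N %| _)%N); last first.
  rewrite /q0; case: ifP => h.
    by rewrite (_ : (_ + _ = 2 * N)%N) //; lia.
  apply/dvdnP; exists 2%N; lia.
rewrite mulrC; congr (_ * _); rewrite !mxE /= ifN; last first.
  by rewrite /q0; case: ifP => h; lia.
rewrite (_ : (if (q0 < N)%N then q0%:Z else q0%:Z - (2 * N)%:Z) = n%:Z - m%:Z) //.
by rewrite /q0; case: (leqP m n) => h; case: ifP => h1; lia.
Qed.

(** The DFT diagonalizes the circulant matrix, with eigenvalues [muvec w x]; on a vector padded with
    zeros its quadratic form is that of the block [Rmx w x]. *)
Lemma sum_mu_padded_dft w x d :
  \sum_i muvec w x i 0 * sqn (padded_dft d i) = (2 * N)%:R * rdot d (Rmx w x *m d).
Proof.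
transitivity (Re (\sum_(i < 2 * N) \sum_(q < 2 * N) cvec w x q 0 *
   (uroot R (2 * N) ^+ (i * q) * (padded_dft d i * conjc (padded_dft d i))))).
  rewrite Re_sum; apply: eq_bigr => i _.
  rewrite -Re_mulC !mxE; under [in RHS]eq_bigr do rewrite mulrA.
  rewrite -mulr_suml; under [in RHS]eq_bigr do rewrite mulrC -dftE.
  by rewrite [RHS]ReM !Im_sum; rewrite !ReImE; ring.
rewrite exchange_big /=.
under eq_bigr do rewrite -mulr_sumr sum_padded_dft.
transitivity (Re (\sum_(n < N) \sum_(m < N)
   (d m 0 * conjc (d n 0) * ((2 * N)%:R * Rmx w x n m)))).
  congr (complex.Re _); under eq_bigr do rewrite mulr_sumr.
  rewrite exchange_big [RHS]exchange_big; apply: eq_bigr => m _ /=.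
  under eq_bigr do rewrite mulr_sumr.
  rewrite exchange_big; apply: eq_bigr => n _ /=.
  by rewrite -sum_cvec mulr_sumr; apply: eq_bigr => q _; rewrite mulrCA.
rewrite Re_sum mulr_sumr; apply: eq_bigr => n _.
rewrite mxE dotc_sumr mulr_sumr Re_sum; apply: eq_bigr => m _.
rewrite -(rmorph_nat (real_complex R)) /dotc !ReImE /=; ring.
Qed.

Lemma rdot_Rmx_le w x d : rdot d (Rmx w x *m d) <= lambdau w x * rdot d d.
Proof.
pose me : R := seqmax [seq muvec w x i 0 | i : 'I_(2 * N) <- enum 'I_(2 * N) & ~~ odd i].
pose mo : R := seqmax [seq muvec w x i 0 | i : 'I_(2 * N) <- enum 'I_(2 * N) & odd i].
have N2 : (0 : R) < (2 * N)%:R by rewrite ltr0n; lia.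
rewrite -(ler_pM2l N2) -sum_mu_padded_dft.
(* The coefficient (mo + me) / 2 + (-1)^i (me - mo) / 2 is [me] at even i and [mo] at odd i; the
   alternating part sums to zero, which leaves the mean [lambdau]. *)
apply: (@le_trans _ _ (\sum_(i < 2 * N) ((mo + me) / 2 * sqn (padded_dft d i) +
    (me - mo) / 2 * ((-1) ^+ i * sqn (padded_dft d i))))); last first.
  rewrite big_split /= -!mulr_sumr sum_sqn_padded_dft sum_alt_sqn_padded_dft.
  by rewrite /lambdau -/me -/mo; lra.
apply: ler_sum => i _.
have s0 := sqn_ge0 (padded_dft d i).
have [oi|ei] := boolP (odd i).
  have h : muvec w x i 0 <= mo.
    by apply: ler_seqmax; apply: map_f; rewrite mem_filter oi mem_enum.
  by rewrite -signr_odd oi; nra.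
have h : muvec w x i 0 <= me.
  by apply: ler_seqmax; apply: map_f; rewrite mem_filter ei mem_enum.
by rewrite -signr_odd (negbTE ei); nra.
Qed.
End Circulant.

(** * The real-valued modulus and phase inequalities *)

Section Modulus.
Variable R : realType.
Implicit Types a b z : R[i].

(* Im (a^* b) *)
Definition crossc a b : R := Re a * Im b - Im a * Re b.
(** The norm on [R[i]] takes its values in [R[i]]; this is the same modulus as a real number. *)
Definition modc z : R := Re `|z|.

Lemma modcE z : (modc z)%:C = `|z|.
Proof. by rewrite /modc normc_def. Qed.

Lemma modc_ge0 z : 0 <= modc z.
Proof. by rewrite -ler0c modcE. Qed.

Lemma modc_sqr z : modc z ^+ 2 = sqn z.
Proof. exact: sqnE. Qed.

Lemma modcM a b : modc (a * b) = modc a * modc b.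
Proof. by apply: complexI; rewrite rmorphM !modcE normrM. Qed.

Lemma modcD a b : modc (a + b) <= modc a + modc b.
Proof. by rewrite -lecR rmorphD !modcE ler_normD. Qed.

Lemma modcN a : modc (- a) = modc a.
Proof. by rewrite /modc normrN. Qed.

Lemma modcJ a : modc (conjc a) = modc a.
Proof. by rewrite /modc !normc_def Re_conj Im_conj sqrrN. Qed.

Lemma modc_sum (I : Type) (r : seq I) (P : pred I) (F : I -> R[i]) :
  modc (\sum_(i <- r | P i) F i) <= \sum_(i <- r | P i) modc (F i).
Proof.
by rewrite -lecR rmorph_sum modcE (le_trans (ler_norm_sum _ _ _)).
Qed.

Lemma modc_real (t : R) : modc t%:C = `|t|.
Proof. by rewrite /modc normc_def /= expr0n addr0 sqrtr_sqr. Qed.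

Lemma modc1P z : sqn z = 1 -> modc z = 1.
Proof. by move/norm1_sqn; rewrite /modc => ->. Qed.

Lemma dotc_cross a b : dotc a b ^+ 2 + crossc a b ^+ 2 = sqn a * sqn b.
Proof. by rewrite /sqn /dotc /crossc; ring. Qed.

Lemma dotc_le a b : sqn a = 1 -> dotc a b <= modc b.
Proof.
move=> a1; rewrite (le_trans (ler_norm _)) // -ler_sqr ?nnegrE ?modc_ge0 //.
rewrite modc_sqr real_normK ?num_real //; have := dotc_cross a b.
by have := sqr_ge0 (crossc a b); rewrite a1; lra.
Qed.

Lemma ler_Re_modc z : `|Re z| <= modc z.
Proof.
rewrite -ler_sqr ?nnegrE ?modc_ge0 // modc_sqr real_normK ?num_real // /sqn /dotc -!expr2.
by rewrite lerDl sqr_ge0.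
Qed.

(** Here |b|^2 - ([dotc a b])^2 factors as (|b| - [dotc a b]) (|b| + [dotc a b]), and the second
    factor is at most 2 |b|. This turns a small decrement of the objective into a small imaginary
    part. *)
Lemma crossc_sqr_le a b : sqn a = 1 ->
  crossc a b ^+ 2 <= 2 * modc b * (modc b - dotc a b).
Proof.
move=> a1; have := dotc_cross a b; have := dotc_le b a1.
by rewrite a1 mul1r -modc_sqr => h /eqP; rewrite eq_sym addrC -subr_eq => /eqP <-; nra.
Qed.

Lemma ler_norm_seqmax (s : seq R) K : 0 <= K -> (forall v, v \in s -> `|v| <= K) ->
  `|seqmax s| <= K.
Proof.
(* The maximum of the empty list is the default value 0. *)
move=> K0; case: s => [|v s] sK; first by rewrite /seqmax big_nil normr0.
have vs : v \in v :: s by rewrite mem_head.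
rewrite ler_norml; apply/andP; split.
  apply: le_trans (ler_seqmax vs); have := sK _ vs.
  by rewrite ler_norml => /andP[].
rewrite /seqmax big_seq; apply: bigmax_le => [|u us].
  by apply: le_trans (ler_norm _) (sK _ vs).
by apply: le_trans (ler_norm _) (sK _ us).
Qed.

End Modulus.

(** * Majorization, descent, and boundedness of [yvec] *)

Section Descent.
Variables (R : realType) (N : nat).
Implicit Types (w : nat -> R) (x a d : 'cV[R[i]]_N).

Lemma rdot_unimodular x : unimodular x -> rdot x x = N%:R.
Proof.
move=> Ux; rewrite -[in RHS](card_ord N) -sumr_const; apply: eq_bigr => n _.
exact/norm1_sqn.
Qed.

(** On the torus |a - x|^2 = 2 (N - Re (x^H a)) is affine in [a], so the remainder in [wislD] can be
    dominated by an affine function of [a]. *)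
Lemma wisl_majorization w x a : (2 <= N)%N ->
  (forall k, (1 <= k < N)%N -> 0 <= w k) -> unimodular x -> unimodular a ->
  wisl w a <= wisl w x - 2 * rdot (a - x) (yvec w x).
Proof.
move=> N2 w0 Ux Ua; have [d dE] : exists d, d = a - x by exists (a - x).
have N0 : (0 < N)%N by lia.
have aE : a = x + d by rewrite dE addrC subrK.
have dd : rdot d d = 2 * (N%:R - rdot x a).
  rewrite dE rdotDr rdotNr ![rdot (a - x) _]rdotC !rdotDr !rdotNr (rdotC a x).
  by rewrite !rdot_unimodular //; ring.
have dx : rdot d x = rdot x a - N%:R.
  by rewrite dE rdotC rdotDr rdotNr rdot_unimodular.
have := wislD w x d; rewrite -aE => ->.
have := acorr_dist a x N2 w0; have := outer_dist Ua Ux.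
have := rdot_Rmx_le N0 w x d; have := lambdaL_ge0 N2 w0.
rewrite -dE /yvec rdotDr rdotNr rdotZr dx dd.
set f' := \sum_(_ <= _ < _) _; set G := \sum_n _.
move: (lambdaL N w) (lambdau w x) (rdot x a) (N%:R : R) (wisl w x) => L u q M f.
move=> L0 h1 h2 h3.
have h4 : L / 2 * G <= L * (M ^+ 2 - q ^+ 2) by nra.
(* With q = [rdot x a] and M = N, (M - q)^2 is the gap between 2 M (M - q) and M^2 - q^2; adding it
   replaces the quadratic bound of [outer_dist] by an affine one, whence the coefficient
   [lambdaL w * N%:R] in [yvec]. *)
have h5 : 0 <= L * (M - q) ^+ 2 by rewrite mulr_ge0 ?sqr_ge0.
nra.
Qed.

Lemma mwisl_step_unimodular w x a : mwisl_step w x a -> unimodular a.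
Proof.
move=> st n; have [t [_ ->]] := st n.
by apply/norm1_sqn; rewrite sqn_cis.
Qed.

(** The phase chosen at a zero entry of [yvec] is harmless, since both sides then vanish. *)
Lemma mwisl_step_dotc w x a n : mwisl_step w x a ->
  dotc (a n 0) (yvec w x n 0) = modc (yvec w x n 0).
Proof.
move=> st; have [t [yE ->]] := st n; rewrite [in LHS]yE -modcE.
have := sqn_cis t; rewrite /sqn /dotc !ReImE /= => h.
transitivity (modc (yvec w x n 0) * (cos t * cos t + sin t * sin t)); first by ring.
by rewrite h mulr1.
Qed.

Lemma mwisl_descent w x a (n : 'I_N) : (2 <= N)%N ->
  (forall k, (1 <= k < N)%N -> 0 <= w k) -> unimodular x -> mwisl_step w x a ->
  2 * (modc (yvec w x n 0) - dotc (x n 0) (yvec w x n 0)) <= wisl w x - wisl w a.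
Proof.
move=> N2 w0 Ux st; have Ua := mwisl_step_unimodular st.
have := wisl_majorization N2 w0 Ux Ua.
rewrite rdotC rdotDr rdotNr !(rdotC (yvec w x)) /rdot.
under eq_bigr do rewrite (mwisl_step_dotc _ st).
(* The guaranteed decrease is a sum over all indices of nonnegative terms; only the n-th is kept. *)
rewrite -sumrB (bigD1 n) //=; set S := \sum_(_ | _) _.
have : 0 <= S.
  by apply: sumr_ge0 => m _; rewrite subr_ge0 dotc_le //; apply/norm1_sqn.
lra.
Qed.

(** The vectors [yvec w x] and [- (Rmx w x *m x)] differ by a real multiple of [x], which
    contributes nothing to the imaginary part of x_n^* y_n. *)
Lemma crossc_yvec w x n :
  crossc (x n 0) (yvec w x n 0) = - crossc (x n 0) ((Rmx w x *m x) n 0).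
Proof. by rewrite /yvec; do 3 rewrite mxE; rewrite /crossc !ReImE /=; ring. Qed.

Lemma modc_acorr x k : unimodular x -> modc (acorr x k) <= N%:R ^+ 2.
Proof.
move=> Ux; have h p : modc (acorr_nat x p) <= N%:R ^+ 2.
  apply: le_trans (modc_sum _ _ _) _; rewrite expr2 -[X in X%:R * _](card_ord N).
  rewrite mulr_natl -sumr_const; apply: ler_sum => n _.
  apply: le_trans (modc_sum _ _ _) _.
  rewrite -[X in _ <= X%:R](card_ord N) -sumr_const big_mkcond; apply: ler_sum => m _.
  case: ifP => // _; rewrite modcM modcJ !modc1P ?mulr1 //; exact/norm1_sqn.
by case: k => p //=; rewrite modcJ.
Qed.

Lemma modc_weighted_acorr w x k : unimodular x ->
  modc ((wext w k)%:C * acorr x k) <= `|wext w k| * N%:R ^+ 2.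
Proof. by move=> Ux; rewrite modcM modc_real ler_wpM2l ?modc_acorr. Qed.

(** The constant is uniform over the torus: autocorrelations are at most N^2 in modulus and the DFT
    kernel has modulus 1, so [muvec], [lambdau] and [Rmx] are bounded in terms of [w] and [N]. *)
Lemma yvec_bounded w n : (0 < N)%N ->
  exists K : R, forall x, unimodular x -> modc (yvec w x n 0) <= K.
Proof.
move=> N0.
(* The lag of the autocorrelation stored at position [q] of [cvec]. *)
pose c (q : 'I_(2 * N)) := (if (q < N)%N then q%:Z else q%:Z - (2 * N)%:Z).
pose Kmu := \sum_(q < 2 * N) `|wext w (c q)| * N%:R ^+ 2.
pose KR := \sum_(m < N) `|wext w (n%:Z - m%:Z)| * N%:R ^+ 2.
have Kmu0 : 0 <= Kmu by apply: sumr_ge0 => q _; rewrite mulr_ge0 ?sqr_ge0.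
exists (`|lambdaL N w| * N%:R + Kmu + KR) => x Ux.
have xn m : modc (x m 0) = 1 by rewrite modc1P //; exact/norm1_sqn.
have muK i : `|muvec w x i 0| <= Kmu.
  rewrite mxE (le_trans (ler_Re_modc _)) // mxE.
  apply: le_trans (modc_sum _ _ _) _; apply: ler_sum => q _.
  rewrite mxE modcM modc1P ?sqn_cis // mul1r mxE.
  case: ifP => _; last exact: modc_weighted_acorr.
  by rewrite modc_real normr0 mulr_ge0 ?sqr_ge0.
have uK : `|lambdau w x| <= Kmu.
  have sK p : `|seqmax [seq muvec w x i 0 | i : 'I_(2 * N) <- enum 'I_(2 * N) & p i]| <= Kmu.
    by apply: ler_norm_seqmax => // v /mapP[i _ ->].
  rewrite normrM [X in _ * X]ger0_norm ?invr_ge0 // ler_pdivrMr //.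
  by rewrite (le_trans (ler_normD _ _)) // mulr_natr mulr2n lerD.
rewrite /yvec; do 3 rewrite mxE; apply: le_trans (modcD _ _) _; rewrite modcN modcM xn mulr1.
apply: lerD.
  rewrite modc_real (le_trans (ler_normD _ _)) // normrM normr_nat.
  exact: lerD.
rewrite mxE (le_trans (modc_sum _ _ _)) //; apply: ler_sum => m _.
by rewrite modcM xn mulr1 mxE modc_weighted_acorr.
Qed.
End Descent.

(** * The gradient of the objective and the tangent cone of the torus *)

Section Gradient.
Variables (R : realType) (N : nat).
Implicit Types (w : nat -> R) (x a d : 'cV[R[i]]_N).

Lemma realifyK : cancel (@realify R N) (@complexify R N).
Proof.
move=> x; apply/colP => n; rewrite mxE /realify col_mxKu col_mxKd !mxE.
exact: complex_ext.
Qed.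

Lemma complexify_line (v h : 'cV[R]_(N + N)) (t : R) :
  complexify (t *: h + v) = complexify v + t%:C *: complexify h.
Proof.
by apply/colP => n; rewrite !mxE; apply: complex_ext; rewrite !ReImE /=; ring.
Qed.

(** On a line where [f] is a polynomial of degree at most 4, the difference quotient is itself a
    polynomial in t, with value [b] at 0. *)
Lemma derive_quartic (V : normedModType R) (f : V -> R) (v h : V) (b c2 c3 c4 : R) :
  (forall t : R, f (t *: h + v) = f v + t * (b + t * (c2 + t * (c3 + t * c4)))) ->
  'D_h f v = b.
Proof.
move=> fE; apply: cvg_lim => //.
pose g (t : R) := b + t * (c2 + t * (c3 + t * c4)).
have g0 : g t @[t --> (0 : R)^'] --> b.
  have -> : b = g 0 by rewrite /g mul0r addr0.
  apply: cvg_within_filter.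
  by do 3 (apply: cvgD; [exact: cvg_cst|apply: cvgM; [exact: cvg_id|]]); exact: cvg_cst.
apply: cvg_trans g0; apply: near_eq_cvg; near=> t.
have t0 : t != 0 by near: t; exact: nbhs_dnbhs_neq.
by rewrite /= fE /g addrAC subrr add0r scalerA mulVf // scale1r.
Unshelve. all: by end_near. Qed.

Lemma xcorrZr x d (t : R) k : xcorr x (t%:C *: d) k = t%:C * xcorr x d k.
Proof.
rewrite /xcorr mulr_sumr; apply: eq_bigr => n _.
rewrite mulr_sumr; apply: eq_bigr => m _.
by rewrite mxE; ring.
Qed.

Lemma xcorrZl x d (t : R) k : xcorr (t%:C *: x) d k = t%:C * xcorr x d k.
Proof.
rewrite /xcorr mulr_sumr; apply: eq_bigr => n _.
rewrite mulr_sumr; apply: eq_bigr => m _.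
by rewrite mxE conjcM conjc_real mulrA.
Qed.

Lemma derive_wisl_real w (v h : 'cV[R]_(N + N)) :
  'D_h (wisl_real w) v =
  2 * rdot (complexify h) (Rmx w (complexify v) *m complexify v).
Proof.
pose x := complexify v; pose d := complexify h.
(* Along x + t d the increment of the k-th autocorrelation is t [B k] + t^2 [A k]; expanding its
   squared modulus gives the coefficients below. *)
pose B k := xcorr x d k + xcorr d x k.
pose A k := xcorr d d k.
apply: (@derive_quartic _ _ _ _ _ (rdot d (Rmx w x *m d) + \sum_(1 <= k < N) w k * sqn (B k))
   (\sum_(1 <= k < N) w k * (2 * dotc (B k) (A k)))
   (\sum_(1 <= k < N) w k * sqn (A k))) => t.
rewrite /wisl_real complexify_line wislD -/x -/d.
rewrite -scalemxAr !rdotZr !(rdotC (t%:C *: d)) !rdotZr.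
rewrite (rdotC _ d) (rdotC _ d).
have -> : \sum_(1 <= k < N) w k * sqn (acorr_nat (x + t%:C *: d) k - acorr_nat x k) =
  t ^+ 2 * (\sum_(1 <= k < N) w k * sqn (B k) +
  t * (\sum_(1 <= k < N) w k * (2 * dotc (B k) (A k)) +
  t * (\sum_(1 <= k < N) w k * sqn (A k)))).
  rewrite !(mulr_sumr, =^~ big_split) /=; apply: eq_bigr => k _.
  rewrite acorr_natD !xcorrZr !xcorrZl /B /A /sqn /dotc !ReImE /=; ring.
ring.
Qed.

(** The partial derivatives along the real and imaginary directions of coordinate n are twice the
    real and imaginary parts of (R x)_n. *)
Lemma gradient_dot w x (z : 'cV[R]_(N + N)) :
  ((gradient (wisl_real w) (realify x))^T *m z) 0 0 =
  2 * rdot (complexify z) (Rmx w x *m x).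
Proof.
rewrite mxE; under eq_bigr do rewrite !mxE derive_wisl_real realifyK.
move: (Rmx w x *m x) => y.
rewrite big_split_ord /= -big_split [in RHS]/rdot mulr_sumr; apply: eq_bigr => n _ /=.
have -> : rdot (complexify (delta_mx (lshift N n) 0)) y = Re (y n 0).
  rewrite /rdot (bigD1 n) //= big1 => [|m mn].
    by rewrite !mxE /dotc /= !eqxx eq_rlshift /=; ring.
  by rewrite !mxE /dotc /= !eq_lshift eq_rlshift (negbTE mn) /=; ring.
have -> : rdot (complexify (delta_mx (rshift N n) 0)) y = Im (y n 0).
  rewrite /rdot (bigD1 n) //= big1 => [|m mn].
    by rewrite !mxE /dotc /= !eqxx eq_lrshift /=; ring.
  by rewrite !mxE /dotc /= !eq_rshift eq_lrshift (negbTE mn) /=; ring.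
by rewrite !mxE /dotc /=; ring.
Qed.

Lemma cvgn_eq (u : nat -> R) (a b : R) :
  u l @[l --> \oo] --> a -> u l @[l --> \oo] --> b -> a = b.
Proof.
by move=> ua ub; rewrite -(cvg_lim (@Rhausdorff R) ua); apply: cvg_lim.
Qed.

Lemma cvg_coord (d : nat) (u : nat -> 'cV[R]_d) (v : 'cV[R]_d) (i : 'I_d) :
  u l @[l --> \oo] --> v -> u l i 0 @[l --> \oo] --> v i 0.
Proof.
by move=> uv; apply: (cvg_comp u (fun M : 'cV[R]_d => M i 0) uv); exact: coord_continuous.
Qed.

(** On the n-th coordinate circle, u and v have equal norms, so u + v is orthogonal to u - v.
    Dividing by [tau] and passing to the limit shows that 2 v is orthogonal to z there. *)
Lemma torus_tangent x (z : 'cV[R]_(N + N)) n :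
  tangent_cone (@torus R N) (realify x) z ->
  unimodular x -> dotc (x n 0) (complexify z n 0) = 0.
Proof.
move=> [u [tau [uC uv tau0 _ qz]]] Ux.
have v1 : realify x (lshift N n) 0 = Re (x n 0) by rewrite /realify col_mxEu mxE.
have v2 : realify x (rshift N n) 0 = Im (x n 0) by rewrite /realify col_mxEd mxE.
move: (realify x) v1 v2 uv qz => v v1 v2 uv qz.
have := @cvg_coord _ _ _ (lshift N n) uv; have := @cvg_coord _ _ _ (rshift N n) uv.
have := @cvg_coord _ _ _ (lshift N n) qz; have := @cvg_coord _ _ _ (rshift N n) qz.
rewrite v1 v2 => q2 q1 u2 u1.
rewrite /complexify mxE /dotc /= !mxE.
pose g i := (u i (lshift N n) 0 + Re (x n 0)) *
    ((tau i)^-1 *: (u i - v)) (lshift N n) 0 +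
  (u i (rshift N n) 0 + Im (x n 0)) *
    ((tau i)^-1 *: (u i - v)) (rshift N n) 0.
have g_lim : g i @[i --> \oo] -->
    (Re (x n 0) + Re (x n 0)) * z (lshift N n) 0 +
    (Im (x n 0) + Im (x n 0)) * z (rshift N n) 0.
  by apply: cvgD; apply: cvgM => //; apply: cvgD => //; apply: cvg_cst.
have g0 : g = fun=> 0.
  apply/funext => i; rewrite /g !mxE v1 v2.
  have := uC i n; rewrite !mxE.
  have := Ux n => /norm1_sqn; rewrite /sqn /dotc => h1 h2.
  transitivity ((tau i)^-1 * ((u i (lshift N n) 0 ^+ 2 + u i (rshift N n) 0 ^+ 2) -
    (Re (x n 0) * Re (x n 0) + Im (x n 0) * Im (x n 0)))).
    by ring.
  by rewrite h1 h2 subrr mulr0.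
rewrite g0 in g_lim.
have h : (Re (x n 0) + Re (x n 0)) * z (lshift N n) 0 +
    (Im (x n 0) + Im (x n 0)) * z (rshift N n) 0 = 0.
  exact: cvgn_eq g_lim (cvg_cst _).
lra.
Qed.
End Gradient.

(** * Passage to the limit along a subsequence *)

Section Limits.
Variable R : realType.
Implicit Types (u : nat -> R[i]).

Definition ccvg u (l : R[i]) : Prop :=
  Re (u i) @[i --> \oo] --> Re l /\ Im (u i) @[i --> \oo] --> Im l.

Lemma ccvg_cst l : ccvg (fun=> l) l.
Proof. by split; apply: cvg_cst. Qed.

Lemma ccvgD u1 u2 l1 l2 : ccvg u1 l1 -> ccvg u2 l2 ->
  ccvg (fun i => u1 i + u2 i) (l1 + l2).
Proof.
move=> [r1 i1] [r2 i2]; split; rewrite !ReImE; under eq_fun do rewrite !ReImE.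
  exact: cvgD.
exact: cvgD.
Qed.

Lemma ccvgM u1 u2 l1 l2 : ccvg u1 l1 -> ccvg u2 l2 ->
  ccvg (fun i => u1 i * u2 i) (l1 * l2).
Proof.
move=> [r1 i1] [r2 i2]; split; rewrite !ReImE; under eq_fun do rewrite !ReImE.
  by apply: cvgB; apply: cvgM.
by apply: cvgD; apply: cvgM.
Qed.

Lemma ccvgJ u l : ccvg u l -> ccvg (fun i => conjc (u i)) (conjc l).
Proof.
move=> [r1 i1]; split; rewrite ReImE; under eq_fun do rewrite ReImE; first exact: r1.
exact: cvgN.
Qed.

Lemma ccvg_sum (I : Type) (r : seq I) (P : pred I) (F : I -> nat -> R[i]) l :
  (forall j, P j -> ccvg (F j) (l j)) ->
  ccvg (fun i => \sum_(j <- r | P j) F j i) (\sum_(j <- r | P j) l j).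
Proof.
move=> Fl; elim: r => [|j r IH].
  by rewrite big_nil; under eq_fun do rewrite big_nil; apply: ccvg_cst.
rewrite big_cons; under eq_fun do rewrite big_cons; case: ifP => // Pj.
by apply: ccvgD => //; apply: Fl.
Qed.

Lemma cvg_crossc u1 u2 l1 l2 : ccvg u1 l1 -> ccvg u2 l2 ->
  crossc (u1 i) (u2 i) @[i --> \oo] --> crossc l1 l2.
Proof. by move=> [r1 i1] [r2 i2]; apply: cvgB; apply: cvgM. Qed.

Lemma cvg_sqn u l : ccvg u l -> sqn (u i) @[i --> \oo] --> sqn l.
Proof. by move=> [r1 i1]; apply: cvgD; apply: cvgM. Qed.

Variable N : nat.
Implicit Types (w : nat -> R) (x : nat -> 'cV[R[i]]_N) (xs : 'cV[R[i]]_N).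

Lemma ccvg_realify x xs : realify (x l) @[l --> \oo] --> realify xs ->
  forall n, ccvg (fun l => x l n 0) (xs n 0).
Proof.
move=> h n; split.
  have := @cvg_coord _ _ _ _ (lshift N n) h; rewrite /realify col_mxEu mxE.
  by under eq_fun do rewrite col_mxEu mxE.
have := @cvg_coord _ _ _ _ (rshift N n) h; rewrite /realify col_mxEd mxE.
by under eq_fun do rewrite col_mxEd mxE.
Qed.

Lemma ccvg_Rmx_mul w x xs n : (forall n, ccvg (fun l => x l n 0) (xs n 0)) ->
  ccvg (fun l => (Rmx w (x l) *m x l) n 0) ((Rmx w xs *m xs) n 0).
Proof.
move=> h.
have hn k : ccvg (fun l => acorr_nat (x l) k) (acorr_nat xs k).
  apply: ccvg_sum => p _; apply: ccvg_sum => m _.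
  by apply: ccvgM => //; apply: ccvgJ.
have ha k : ccvg (fun l => acorr (x l) k) (acorr xs k).
  by case: k => k //=; apply: ccvgJ.
rewrite mxE; under eq_fun do rewrite mxE.
apply: ccvg_sum => m _; rewrite mxE; under eq_fun do rewrite mxE.
by apply: ccvgM => //; apply: ccvgM => //; apply: ccvg_cst.
Qed.

Lemma homo_cvgn (phi : nat -> nat) : {homo phi : m n / (m < n)%N} ->
  phi @ \oo --> \oo.
Proof.
move=> hphi; have le_phi n : (n <= phi n)%N.
  elim: n => // n IH; apply: leq_ltn_trans IH (hphi _ _ _) => //.
apply/cvgnyPge => A; near=> n.
by apply: leq_trans (le_phi n); near: n; exact: nbhs_infty_ge.
Unshelve. all: by end_near. Qed.

Lemma wisl_ge0 w (x : 'cV[R[i]]_N) : (forall k, (1 <= k < N)%N -> 0 <= w k) ->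
  0 <= wisl w x.
Proof.
move=> w0; rewrite wislE big_nat; apply: sumr_ge0 => k kN.
by rewrite mulr_ge0 ?w0 ?sqn_ge0.
Qed.

Lemma mwisl_unimodular w x : mwisl_sequence w x -> forall l, unimodular (x l).
Proof.
by move=> [U0 st] [|l] //; apply: mwisl_step_unimodular (st l).
Qed.

Lemma mwisl_decrement_cvg0 w x : (2 <= N)%N ->
  (forall k, (1 <= k < N)%N -> 0 <= w k) -> mwisl_sequence w x ->
  wisl w (x l) - wisl w (x l.+1) @[l --> \oo] --> (0 : R).
Proof.
move=> N2 w0 hx; have U := mwisl_unimodular hx.
have dec : nonincreasing_seq (fun l => wisl w (x l)).
  apply/nonincreasing_seqP => l; rewrite -subr_ge0.
  (* Any coordinate gives monotonicity; index 0 is taken. *)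
  apply: le_trans (mwisl_descent (Ordinal (ltnW N2)) N2 w0 (U l) (hx.2 l)).
  by rewrite mulr_ge0 // subr_ge0 dotc_le //; apply/norm1_sqn/U.
have fc : cvgn (fun l => wisl w (x l)).
  apply: nonincreasing_is_cvgn => //; exists 0 => _ [l _ <-].
  exact: wisl_ge0.
have fc' : wisl w (x l.+1) @[l --> \oo] --> limn (fun l => wisl w (x l)).
  by have := fc; rewrite -[X in X -> _]cvg_shiftS.
rewrite -(subrr (limn (fun l => wisl w (x l)))).
exact: cvgB.
Qed.

Lemma limit_point_crossc0 w x xs n : (2 <= N)%N ->
  (forall k, (1 <= k < N)%N -> 0 <= w k) -> mwisl_sequence w x ->
  seq_limit_point x xs -> crossc (xs n 0) ((Rmx w xs *m xs) n 0) = 0.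
Proof.
move=> N2 w0 hx [phi [hphi xphi]]; have U := mwisl_unimodular hx.
have hc := ccvg_realify xphi.
have [K yK] := yvec_bounded w n (ltnW N2 : (0 < N)%N).
(* Stated with R x in place of y, this quantity is polynomial in the real coordinates of the
   iterate, so its limit does not involve the behaviour of [lambdau]. *)
pose c l := crossc (x (phi l) n 0) ((Rmx w (x (phi l)) *m x (phi l)) n 0).
have c_lim := cvg_crossc (hc n) (ccvg_Rmx_mul w n hc).
have cc_lim : c l * c l @[l --> \oo] -->
    crossc (xs n 0) ((Rmx w xs *m xs) n 0) * crossc (xs n 0) ((Rmx w xs *m xs) n 0).
  exact: cvgM.
(* The decrement is that of the full sequence at position [phi l], not the one between consecutive
   terms of the subsequence. *)
have dec0 : K * (wisl w (x (phi l)) - wisl w (x (phi l).+1)) @[l --> \oo] --> (0 : R).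
  rewrite -(mulr0 K); apply: cvgM; first exact: cvg_cst.
  exact: cvg_comp (homo_cvgn hphi) (mwisl_decrement_cvg0 N2 w0 hx).
have cc0 : c l * c l @[l --> \oo] --> (0 : R).
  (* The chain is c^2 <= 2 |y_n| (|y_n| - Re (x_n^* y_n)) <= K times the decrement. *)
  apply: squeeze_cvgr (cvg_cst 0) dec0; near=> l.
  rewrite -expr2 sqr_ge0 /=.
  have xn1 : sqn (x (phi l) n 0) = 1 by apply/norm1_sqn/U.
  have := crossc_sqr_le (yvec w (x (phi l)) n 0) xn1.
  rewrite crossc_yvec sqrrN -/(c l) => /le_trans; apply.
  have := mwisl_descent n N2 w0 (U (phi l)) (hx.2 (phi l)).
  have := dotc_le (yvec w (x (phi l)) n 0) xn1.
  have := yK _ (U (phi l)); have := modc_ge0 (yvec w (x (phi l)) n 0).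
  move: (modc _) (dotc _ _) (wisl w _ - _) => M p D M0 MK pM DM.
  by nra.
by move: (cvgn_eq cc_lim cc0) => /eqP; rewrite mulf_eq0 orbb => /eqP.
Unshelve. all: by end_near. Qed.

Lemma limit_point_unimodular w x xs : mwisl_sequence w x ->
  seq_limit_point x xs -> unimodular xs.
Proof.
move=> hx [phi [hphi xphi]] n; have U := mwisl_unimodular hx.
apply/norm1_sqn; have := cvg_sqn (ccvg_realify xphi n).
move=> sq_lim; apply: cvgn_eq sq_lim _.
rewrite (_ : (fun l => _) = fun=> 1); first exact: cvg_cst.
by apply/funext => l; apply/norm1_sqn/U.
Qed.
End Limits.

Theorem theorem9 (R : realType) (N : nat) (hN : (2 <= N)%N) (w : nat -> R)
    (hw : forall k : nat, (1 <= k < N)%N -> 0 <= w k)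
    (x : nat -> 'cV[R[i]]_N) (hx : mwisl_sequence w x) (xs : 'cV[R[i]]_N) :
  seq_limit_point x xs -> stationary_point w xs.
Proof.
move=> lim_xs; have Uxs := limit_point_unimodular hx lim_xs; split=> // z Tz.
rewrite gradient_dot /rdot big1 ?mulr0 // => n _.
have xn1 : sqn (xs n 0) = 1 by apply/norm1_sqn.
have yx := limit_point_crossc0 n hN hw hx lim_xs.
have zx := torus_tangent n Tz Uxs.
(* Multiplying both arguments by the conjugate of the unimodular xs_n preserves their inner product.
   The product of real parts then vanishes by tangency, and that of imaginary parts because xs_n^*
   (R xs)_n is real. *)
rewrite -[LHS]mul1r -xn1 (_ : _ * _ = dotc (xs n 0) (complexify z n 0) *
      dotc (xs n 0) ((Rmx w xs *m xs) n 0) +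
    crossc (xs n 0) (complexify z n 0) *
      crossc (xs n 0) ((Rmx w xs *m xs) n 0)).
  by rewrite yx zx mul0r mulr0 addr0.
rewrite /sqn /dotc /crossc; ring.
Qed.
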